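(* There exist a domain $X$ with $|X|=8$, a hypothesis class $\mathcal{H}$ of functions $X\to\{0,1\}$ with $\mathrm{VC}(\mathcal{H})=1$, a perturbation type $\mathcal{U}:X\to 2^X$, and two distributions $P^1$ and $P^2$ over $X\times\{0,1\}$, such that there are functions $h_r,h_c\in\mathcal{H}$ with $\mathcal{L}^{0/1}_{P^i}(h_r)=0$ and $P^i(\mathrm{mar}^{\mathcal{U}}_{h_c})=0$ for both $i\in\{1,2\}$, while $P^1$ and $P^2$ are indistinguishable with error and margin oracles for $\mathcal{H}$ (that is, $P^1(\mathrm{err}_h)=P^2(\mathrm{err}_h)$ and $P^1(\mathrm{mar}^{\mathcal{U}}_h)=P^2(\mathrm{mar}^{\mathcal{U}}_h)$ for every $h\in\mathcal{H}$) and the minimizers in $\mathcal{H}$ of the robust losses $\mathcal{L}^{\mathcal{U}}_{P^1}$ and $\mathcal{L}^{\mathcal{U}}_{P^2}$ differ.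
   Context: A perturbation type is a map $\mathcal{U}:X\to 2^X$ with $x\in\mathcal{U}(x)$ for all $x$. For $h:X\to\{0,1\}$, the error region is $\mathrm{err}_h=\{(x,y)\in X\times\{0,1\}: h(x)\neq y\}$ and the margin area is $\mathrm{mar}^{\mathcal{U}}_h=\{(x,y)\in X\times\{0,1\}:\exists z\in\mathcal{U}(x),\ h(x)\neq h(z)\}$. The binary loss is $\mathcal{L}^{0/1}_P(h)=P(\mathrm{err}_h)$. The robust loss is $\mathcal{L}^{\mathcal{U}}_P(h)=\Pr_{(x,y)\sim P}[\exists z\in\mathcal{U}(x): h(z)\neq y]=P(\mathrm{err}_h\cup\mathrm{mar}^{\mathcal{U}}_h)$. An error oracle for $\mathcal{H}$ returns $P(\mathrm{err}_h)$ for any queried $h\in\mathcal{H}$, and a margin oracle for $\mathcal{H}$ returns $P(\mathrm{mar}^{\mathcal{U}}_h)$ for any queried $h\in\mathcal{H}$. *)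

(* Defs.v *)
From HB Require Import structures.
From mathcomp Require Import all_boot all_order all_algebra reals.
Set Implicit Arguments.
Unset Strict Implicit.
Unset Printing Implicit Defensive.
Import Order.TTheory GRing.Theory Num.Theory.
Local Open Scope ring_scope.

(* On a finite type every subset is measurable, so a probability distribution
   is given by its mass function. *)
Record distribution (R : realType) (T : finType) := Distribution {
  mass :> T -> R;
  mass_ge0 : forall t, 0 <= mass t;
  mass_sum1 : \sum_t mass t = 1
}.

Definition Pr (R : realType) (T : finType) (P : distribution R T)
    (A : {set T}) : R := \sum_(t in A) P t.

(* The labels 0 and 1 are [false] and [true]. *)
Definition hypothesis (X : finType) := {ffun X -> bool}.

Definition shatters (X : finType) (H : {set hypothesis X}) (S : {set X}) :=
  [forall f : {ffun X -> bool}, exists h in H, forall x in S, h x == f x].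

(* The value on the empty class, which shatters nothing, is 0. *)
Definition VC (X : finType) (H : {set hypothesis X}) : nat :=
  \max_(S : {set X} | shatters H S) #|S|.

Definition perturbation_type (X : finType) (U : X -> {set X}) :=
  forall x, x \in U x.

Definition err (X : finType) (h : hypothesis X) : {set X * bool} :=
  [set p | h p.1 != p.2].

Definition mar (X : finType) (U : X -> {set X}) (h : hypothesis X)
    : {set X * bool} :=
  [set p | [exists z in U p.1, h p.1 != h z]].

Definition binary_loss (R : realType) (X : finType)
    (P : distribution R (X * bool)%type) (h : hypothesis X) : R :=
  Pr P (err h).

Definition robust_loss (R : realType) (X : finType) (U : X -> {set X})
    (P : distribution R (X * bool)%type) (h : hypothesis X) : R :=
  Pr P [set p | [exists z in U p.1, h z != p.2]].

Lemma robust_lossE (R : realType) (X : finType) (U : X -> {set X})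
    (P : distribution R (X * bool)%type) (h : hypothesis X) :
  perturbation_type U -> robust_loss U P h = Pr P (err h :|: mar U h).
Proof.
move=> Uxx; congr (Pr P _); apply/setP => -[x y]; rewrite !inE /=.
apply/exists_inP/orP => [[z Uz hz]|[hx|/exists_inP[z Uz hz]]].
- have [hx|] := eqVneq (h x) y; last by left.
  by right; apply/exists_inP; exists z => //; rewrite hx eq_sym.
- by exists x.
- have [hx|hx] := eqVneq (h x) y; last by exists x.
  by exists z => //; rewrite -hx eq_sym.
Qed.

(* Error and margin oracles for [H] give the same answer to every query. *)
Definition indistinguishable (R : realType) (X : finType)
    (H : {set hypothesis X}) (U : X -> {set X})
    (P1 P2 : distribution R (X * bool)%type) :=
  forall h, h \in H ->
    Pr P1 (err h) = Pr P2 (err h) /\ Pr P1 (mar U h) = Pr P2 (mar U h).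

Definition minimizer (R : realType) (X : finType) (H : {set hypothesis X})
    (L : hypothesis X -> R) (h : hypothesis X) :=
  h \in H /\ forall h', h' \in H -> L h <= L h'.

(* Main.v *)
(* With [hr] free of error and [hc] free of margin, their robust losses are
   [P (mar hr)] and [P (err hc)], hence determined by the oracles. That of a
   third hypothesis [hb] is [P (err hb) + P (mar hb) - P (err hb :&: mar hb)],
   whose last term is invisible. All labels are [true], all masses are multiples
   of [1/5], and each point has at most one other perturbation:

     point          0   1   2   3   4   5   6   7
     perturbation   5   5   6   6   -   -   -   -
     hr             1   1   1   1   1   0   0   0
     hb             0   1   0   1   0   1   0   0
     hc             0   0   0   0   0   0   0   0
     5 P1           2   2   0   0   1   0   0   0
     5 P2           0   0   2   2   1   0   0   0

   Under [P1] error and margin of [hb] overlap at point 0, under [P2] they are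
   disjoint, so the robust loss of [hb] is 3/5 resp. 1, whereas those of
   [hr] and [hc] are 4/5 and 1 in both cases. *)
Require Import Defs.
From mathcomp Require Import all_boot all_order all_algebra reals.
Set Implicit Arguments.
Unset Strict Implicit.
Unset Printing Implicit Defensive.
Import Order.TTheory GRing.Theory Num.Theory.
Local Open Scope ring_scope.

(** Cutting the members of [H] down to [S] yields every subset of [S]. *)
Lemma shatters_card (X : finType) (H : {set hypothesis X}) (S : {set X}) :
  shatters H S -> (2 ^ #|S| <= #|H|)%N.
Proof.
move=> /forallP shHS; rewrite -card_powerset.
pose trace (h : hypothesis X) := [set x in S | h x].
apply: leq_trans (leq_imset_card trace _); apply/subset_leq_card/subsetP => A.
rewrite inE => sAS; have /exists_inP[h Hh hA] := shHS [ffun x => x \in A].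
apply/imsetP; exists h => //; apply/setP => x; rewrite inE.
have [xS|xNS] := boolP (x \in S).
  by have /forall_inP/(_ x xS)/eqP -> := hA; rewrite ffunE.
by apply/negbTE; apply: contra xNS; apply: (subsetP sAS).
Qed.

Lemma shatters1 (X : finType) (H : {set hypothesis X}) (h0 h1 : hypothesis X) x :
  h0 \in H -> h1 \in H -> ~~ h0 x -> h1 x -> shatters H [set x].
Proof.
move=> H0 H1 /negbTE h0x h1x; apply/forallP => f; apply/exists_inP.
exists (if f x then h1 else h0); first by case: ifP.
by apply/forall_inP => y /set1P ->; case: (f x); rewrite ?h0x ?h1x.
Qed.

(** Three hypotheses are too few to shatter two points; disagreement at [x] suffices to shatter
    one. *)
Lemma VC1 (X : finType) (H : {set hypothesis X}) (h0 h1 : hypothesis X) x :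
  (#|H| < 4)%N -> h0 \in H -> h1 \in H -> ~~ h0 x -> h1 x -> VC H = 1%N.
Proof.
move=> H4 H0 H1 h0x h1x; apply/eqP; rewrite eqn_leq; apply/andP; split.
  apply/bigmax_leqP => S /shatters_card shS.
  by rewrite -ltnS -(ltn_exp2l _ _ (ltnSn 1)) (leq_ltn_trans shS).
by rewrite -(cards1 x); apply: leq_bigmax_cond; apply: shatters1 H0 H1 h0x h1x.
Qed.

(** Numerators over 5 are kept in [nat], so that comparing probabilities becomes evaluation of
    closed terms. *)
Definition weight (w : seq nat) (b : pred nat) : nat :=
  sumn [seq nth 0%N w i | i <- iota 0 8 & b i].

Definition true_mass (R : realType) (w : seq nat) (p : 'I_8 * bool) : R :=
  if p.2 then (nth 0%N w p.1)%:R / 5%:R else 0.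

(** Label [false] carries no mass, so only the slice of [A] at label [true] counts. *)
Lemma sum_true_mass (R : realType) (w : seq nat) (A : pred ('I_8 * bool))
    (b : pred nat) :
  (forall i, A (i, true) = b i) ->
  \sum_(t | A t) true_mass R w t = (weight w b)%:R / 5%:R.
Proof.
move=> Ab; rewrite (bigID snd) /= addrC big1 ?add0r; last first.
  by case=> i [] /andP[].
rewrite (reindex (fun i : 'I_8 => (i, true))) /=; last first.
  by exists fst => [i|[i [|]]] //; rewrite inE andbF.
rewrite (eq_bigl (fun i : 'I_8 => b i)) => [|i]; last by rewrite andbT Ab.
rewrite -mulr_suml -natr_sum /weight sumnE big_map big_filter.
by rewrite -(big_mkord b (nth 0%N w)).
Qed.

Lemma true_mass_ge0 (R : realType) w t : 0 <= true_mass R w t.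
Proof. by rewrite /true_mass; case: ifP => // _; rewrite divr_ge0 ?ler0n. Qed.

Lemma true_mass_sum1 (R : realType) w :
  weight w xpredT = 5%N -> \sum_t true_mass R w t = 1.
Proof.
by move=> w5; rewrite (@sum_true_mass _ _ _ xpredT) // w5 divff ?pnatr_eq0.
Qed.

Definition true_distribution (R : realType) w (w5 : weight w xpredT = 5%N) :
    distribution R ('I_8 * bool)%type :=
  Distribution (@true_mass_ge0 R w) (true_mass_sum1 R w5).

Definition hyp (s : seq bool) : hypothesis 'I_8 := [ffun i => nth false s (val i)].

(** A point that is its own partner has no other perturbation. *)
Definition partner (i : nat) : nat := nth 0%N [:: 5; 5; 6; 6; 4; 5; 6; 7]%N i.

Definition perturb (i : 'I_8) : {set 'I_8} := [set i; inord (partner i)].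

Lemma hyp_partner s (i : 'I_8) :
  hyp s (inord (partner i)) = nth false s (partner i).
Proof. by rewrite ffunE /= inordK //; case: i; do 8?case. Qed.

Lemma exists_perturb (i : 'I_8) (Q : pred 'I_8) :
  [exists z in perturb i, Q z] = Q i || Q (inord (partner i)).
Proof.
apply/exists_inP/orP => [[z /set2P[] -> Qz]|[Qz|Qz]]; [by left|by right| |].
  by exists i; rewrite ?set21.
by exists (inord (partner i)); rewrite ?set22.
Qed.

Section TrueDistribution.

Variables (R : realType) (w : seq nat) (w5 : weight w xpredT = 5%N).

Lemma Pr_err s :
  Pr (true_distribution R w5) (err (hyp s))
    = (weight w (fun i => ~~ nth false s i))%:R / 5%:R.
Proof. by apply: sum_true_mass => i; rewrite inE /= ffunE; case: nth. Qed.

Lemma Pr_mar s :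
  Pr (true_distribution R w5) (mar perturb (hyp s))
    = (weight w (fun i => nth false s i != nth false s (partner i)))%:R / 5%:R.
Proof.
apply: sum_true_mass => i.
by rewrite inE /= exists_perturb eqxx /= hyp_partner ffunE.
Qed.

Lemma robust_loss_hyp s :
  robust_loss perturb (true_distribution R w5) (hyp s)
    = (weight w (fun i => ~~ (nth false s i && nth false s (partner i))))%:R
      / 5%:R.
Proof.
apply: sum_true_mass => i.
by rewrite inE /= exists_perturb hyp_partner ffunE negb_and; do 2!case: nth.
Qed.

End TrueDistribution.

Theorem theorem12 (R : realType) :
  exists (X : finType) (H : {set hypothesis X}) (U : X -> {set X})
         (P1 P2 : distribution R (X * bool)%type),
    [/\ #|X| = 8%N, VC H = 1%N & perturbation_type U] /\
    (exists hr hc : hypothesis X,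
       [/\ hr \in H, hc \in H,
           binary_loss P1 hr = 0 /\ binary_loss P2 hr = 0 &
           Pr P1 (mar U hc) = 0 /\ Pr P2 (mar U hc) = 0]) /\
    indistinguishable H U P1 P2 /\
    (forall h1 h2 : hypothesis X,
       minimizer H (robust_loss U P1) h1 -> minimizer H (robust_loss U P2) h2 ->
       h1 <> h2).
Proof.
(* Missing entries read as [false], so [sc] gives the constant 0. *)
pose sr := nseq 5 true; pose sc : seq bool := [::].
pose sb := [:: false; true; false; true; false; true].
pose H := [set hyp sr; hyp sc; hyp sb].
have Hr : hyp sr \in H by rewrite !inE eqxx.
have Hc : hyp sc \in H by rewrite !inE eqxx orbT.
have Hb : hyp sb \in H by rewrite !inE eqxx !orbT.
have w1 : weight [:: 2; 2; 0; 0; 1]%N xpredT = 5%N by [].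
have w2 : weight [:: 0; 0; 2; 2; 1]%N xpredT = 5%N by [].
exists 'I_8, H, perturb, (true_distribution R w1), (true_distribution R w2).
split; [split|split; [|split]].
- exact: card_ord.
- apply: (VC1 (x := ord0) _ Hc Hr); rewrite ?ffunE //.
  rewrite /H setUC cardsU1 cards2.
  by case: (_ \notin _); case: (_ != _).
- by move=> x; rewrite set21.
- by exists (hyp sr), (hyp sc); rewrite /binary_loss !Pr_err !Pr_mar !mul0r.
- by move=> h; rewrite !inE => /orP[/orP[]|] /eqP ->; rewrite !Pr_err !Pr_mar.
have lt5 (m n : nat) : (m%:R / 5%:R <= n%:R / 5%:R :> R) = (m <= n)%N.
  by rewrite ler_pM2r ?invr_gt0 ?ltr0n // ler_nat.
(* No common minimizer: under [P1], [hyp sb] (3/5) beats [hyp sr] (4/5) and [hyp sc] (1); under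
   [P2], [hyp sr] (4/5) beats [hyp sb] (1). *)
move=> h1 h2 [Hh1 min1] [_ min2] eq12; move: Hh1 min1 min2; rewrite -{}eq12.
rewrite !inE => /orP[/orP[]|] /eqP -> min1 min2.
- by have := min1 _ Hb; rewrite !robust_loss_hyp lt5.
- by have := min1 _ Hb; rewrite !robust_loss_hyp lt5.
- by have := min2 _ Hr; rewrite !robust_loss_hyp lt5.
Qed.
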